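(* Let $p$ be a prime, $d\ge 1$ an integer, and let $E\subseteq \mathbb{Z}_p^d$ be a nonempty set with $|E|$ elements. Then: (a) If $E$ is a tiling set, then $|E|=p^r$ for some integer $0\le r\le d$. (b) If $E$ is a spectral set, then $|E|=1$, or $|E|=p^d$, or $|E|=kp$ for some integer $k$ with $1\le k\le p^{d-2}$. (c) If $p=2$ and $E$ is a spectral set in $\mathbb{Z}_2^d$, then $|E|=1$, or $|E|=2$, or $|E|$ is a multiple of $4$. (d) For a subspace $V$ of $\mathbb{Z}_p^d$: $E$ tiles with tiling partner $V$ if and only if $E$ is spectral with spectrum $V^{\perp}$. This happens if and only if $E$ is the graph $\{w+f(w): w\in W\}$ of a function $f:W\to V$ for some subspace $W$ complementary to $V$. (e) If $|E|=p$ or $|E|=p^{d-1}$, then $E$ tiles if and only if $E$ is spectral. Furthermore, when this occurs $E$ has a subspace as a tiling partner and hence is a graph set. (f) If $d\le 2$, then $E$ tiles if and only if $E$ is spectral. Furthermore $E$ is a graph set when this occurs. (g) If $d=3$ and $E$ tiles, then $E$ is spectral. Furthermore $E$ is a graph set when this occurs. (h) If $E$ is a spectral set, then either $E$ tiles, or $E$ $k$-tiles with a hyperplane as partner, where $k=\frac{|E|}{p}$. (i) If $E$ is a spectral set of size $mp$ (with $m\ge 1$ an integer), then there exists a function $f:E\to\mathbb{Z}_m$ such that $\mathrm{Graph}(f)=\{(e,f(e)) : e\in E\}\subseteq \mathbb{Z}_p^d\times\mathbb{Z}_m$ tiles $\mathbb{Z}_p^d\times\mathbb{Z}_m$. Furthermore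 the projection $\mathbb{Z}_p^d\times\mathbb{Z}_m\to\mathbb{Z}_p^d$ forgetting the last coordinate takes $\mathrm{Graph}(f)$ bijectively to $E$. Thus every spectral set is the bijective image of a tiling set under a projection.
   Context: For a positive integer $n$, $\mathbb{Z}_n=\mathbb{Z}/n\mathbb{Z}$. For $p$ prime, $\mathbb{Z}_p^d$ is a vector space over the field $\mathbb{Z}_p$, with dot product $x\cdot y=\sum_i x_iy_i$, and $\chi(u)=e^{2\pi i u/p}$ for $u\in\mathbb{Z}_p$. A subset $E$ of a finite abelian group $G$ tiles $G$ (is a tiling set) with tiling partner $A\subseteq G$ if the translates $E+a$, $a\in A$, partition $G$; equivalently every $x\in G$ can be written uniquely as $e+a$ with $e\in E$, $a\in A$. For $E\subseteq\mathbb{Z}_p^d$, ''tiles'' without further qualification means tiles $\mathbb{Z}_p^d$ with some partner. For an integer $k\ge1$, $E\subseteq\mathbb{Z}_p^d$ $k$-tiles with partner $A\subseteq\mathbb{Z}_p^d$ if every $x\in\mathbb{Z}_p^d$ can be expressed as a sum of an element of $E$ and an element of $A$ in exactly $k$ ways. $E\subseteq\mathbb{Z}_p^d$ is spectral with spectrum $B\subseteq\mathbb{Z}_p^d$ if the functions $x\mapsto\chi(b\cdot x)$, indexed by $b\in B$, form an orthogonal basis of $L^2(E)$, the space of functions $E\to\mathbb{C}$ with inner product $\langle f,g\rangle=\sum_{e\in E}f(e)\overline{g(e)}$. $E$ is a spectral set if it has some spectrum. $V^\perp=\{x\in\mathbb{Z}_p^d: x\cdot v=0\text{ for all }v\in V\}$.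 Subspaces $V,W$ are complementary if $\mathbb{Z}_p^d=V\oplus W$ (either may be $0$). $E$ is a graph set if there are complementary subspaces $V,W$ of $\mathbb{Z}_p^d$ and a function $f:V\to W$ with $E=\{v+f(v): v\in V\}$. A hyperplane is a set $\{x\in\mathbb{Z}_p^d: x\cdot u=t\}$ with $u\ne0$, $t\in\mathbb{Z}_p$. *)

(* Defs.v *)
From HB Require Import structures.
From mathcomp Require Import all_boot all_order all_algebra complex.
From mathcomp Require Import reals trigo.

Set Implicit Arguments.
Unset Strict Implicit.
Unset Printing Implicit Defensive.

Import Order.TTheory GRing.Theory Num.Theory.
Local Open Scope ring_scope.

(* MathComp lacks this join, needed to see (Z_p)^d x Z_m as a finite abelian
   group. *)
HB.instance Definition _ (U V : finZmodType) := GRing.Zmodule.on (U * V)%type.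

Section Tiling.
Variable G : finZmodType.
Implicit Types E A : {set G}.

(* Uniqueness is that of the pair (e, a), so distinct a's give disjoint
   translates. *)
Definition tiles_with E A : Prop :=
  forall x : G, exists! ea : G * G,
    [/\ ea.1 \in E, ea.2 \in A & x = ea.1 + ea.2].

Definition tiles E : Prop := exists A : {set G}, tiles_with E A.

Definition ktiles_with (k : nat) E A : Prop :=
  forall x : G,
    #|[set ea : G * G | [&& ea.1 \in E, ea.2 \in A & x == ea.1 + ea.2]]| = k.

End Tiling.

Section VectorSpace.
Variables p d : nat.
Local Notation Zpd := 'rV['F_p]_d.
Implicit Types (E B H : {set Zpd}) (V W : {vspace Zpd}).

Definition dot (x y : Zpd) : 'F_p := \sum_(i < d) x 0 i * y 0 i.

Definition vset V : {set Zpd} := [set x | x \in V].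

Definition perp V : {set Zpd} := [set x | [forall v in vset V, dot x v == 0]].

Definition complementary V W : Prop :=
  (V + W)%VS = fullv /\ (V :&: W)%VS = 0%VS.

Definition graph_over E V W : Prop :=
  exists f : Zpd -> Zpd,
    {in V, forall v, f v \in W} /\ E = [set v + f v | v in vset V].

Definition graph_set E : Prop :=
  exists V W, complementary V W /\ graph_over E V W.

Definition hyperplane H : Prop :=
  exists (u : Zpd) (t : 'F_p), u != 0 /\ H = [set x | dot x u == t].

End VectorSpace.

Section Spectral.
Variables (R : realType) (p d : nat).
Local Notation Zpd := 'rV['F_p]_d.

(* chi u = exp (2 i pi u / p), with u read as its representative in [0, p). *)
Definition chi (u : 'F_p) : R[i] :=
  let t := 2 * pi * (nat_of_ord u)%:R / p%:R in Complex (cos t) (sin t).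

(* R[i]^o is R[i] as a vector space over itself. *)
Definition L2 (E : {set Zpd}) : vectType R[i] :=
  {ffun {x : Zpd | x \in E} -> R[i]^o}.

Definition inner (E : {set Zpd}) (f g : {ffun {x : Zpd | x \in E} -> R[i]^o}) :
    R[i] :=
  \sum_(e : {x : Zpd | x \in E}) (f e : R[i]) * Num.conj (g e : R[i]).

Definition char_on (E : {set Zpd}) (b : Zpd) :
    {ffun {x : Zpd | x \in E} -> R[i]^o} :=
  [ffun e => chi (dot b (val e))].

(* The basis condition is on the family indexed by B: if two elements of B
   induced the same function on E, the sequence would not be free. *)
Definition spectral_with (E B : {set Zpd}) : Prop :=
  {in B &, forall b c, b != c -> inner (char_on E b) (char_on E c) = 0} /\
  basis_of (fullv : {vspace L2 E}) [seq (char_on E b : L2 E) | b <- enum B].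

Definition spectral (E : {set Zpd}) : Prop :=
  exists B : {set Zpd}, spectral_with E B.

End Spectral.

(* Z_m is 'I_m.-1.+1, which for every m >= 1 is the cyclic group of order m
   (whereas 'Z_1 has two elements). *)
Definition graph_in (p d m : nat) (E : {set 'rV['F_p]_d})
    (f : {x : 'rV['F_p]_d | x \in E} -> 'I_m.-1.+1) :
    {set 'rV['F_p]_d * 'I_m.-1.+1} :=
  [set (val e, f e) | e : {x : 'rV['F_p]_d | x \in E}].

(* Main.v *)
Require Import Defs.
From HB Require Import structures.
From mathcomp Require Import all_boot all_order all_algebra all_field complex.
From mathcomp Require Import reals trigo.
From mathcomp Require Import zify lra.

Set Implicit Arguments.
Unset Strict Implicit.
Unset Printing Implicit Defensive.

Import Order.TTheory GRing.Theory Num.Theory.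
Local Open Scope ring_scope.

(** For a subset E of Z_p^d and a direction u, consider the exponential sum of
    chi (x . u) over E.  Grouping terms by t = x . u turns it into a combination
    of the powers of a primitive p-th root of unity whose coefficients are the
    sizes of the slices of E by the hyperplanes x . u = t.  The only rational
    relations between those powers come from 1 + X + ... + X^(p-1), which is
    irreducible over Q ([rational_relation]); hence the sum vanishes exactly
    when all p slices have the same size ([balancedP]).  In that case E is
    called balanced along u.  This purely combinatorial property is invariant
    under scaling u and carries both sides of the theorem:

    - E is spectral with spectrum B iff B and E have the same size and E is
      balanced along all nonzero differences of elements of B
      ([spectral_withP]); transposing the square character matrix shows that B
      is then spectral with spectrum E ([orthogonal_dual]);
    - if E tiles with A then along each nonzero u either E or A is balanced
      ([tiles_with_balanced]), as the sum over the whole group is the product of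
      the sums over E and A and vanishes.

    When the partner is a subspace V, it is never balanced along V^perp, and
    the two descriptions match: this is [tiles_subspace_spectral].

    Sizes come from pigeonhole.  A set B of more than p^(d-1) elements has two
    elements on some line of every direction, so a set E with spectrum B is
    balanced along every direction; it is then orthogonal for all p^d
    characters, and must be the whole space ([spectral_large]).  As soon as E
    has two points, a single balanced direction shows that p divides #|E|, that
    E multiply tiles with a hyperplane ([balanced_ktiles]), and, by numbering
    each slice from 0 to m - 1, that E lifts to a tile of Z_p^d x Z_m
    ([balanced_lift_tiles]).  For p = 2 and at least three points, two
    independent balanced directions with balanced sum cut E into four equal
    parts ([spectral_char2]).

    For the converse results one has to find a subspace partner.  If #|E| = p,
    a balanced direction u gives one point per hyperplane, so u^perp is a partner
    ([balanced_size_p]).  If #|E| = p^(d-1), the partner is a line: its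
    direction is a difference of two points of A when E tiles with A
    ([tiles_codim1]), and a direction not determined by E when E is spectral
    ([spectral_codim1]).  In dimension at most 3 every power of p that can be
    the size of a tile is 1, p, p^(d-1) or p^d, so all tiles are covered. *)

(** * Rational relations between p-th roots of unity *)

Section RootOfUnity.
Variables (R : realType) (p : nat).
Hypothesis p_prime : prime p.

Definition zeta : R[i] :=
  Complex (cos (2 * pi / p%:R)) (sin (2 * pi / p%:R)).

Lemma zetaX n :
  zeta ^+ n = Complex (cos (2 * pi * n%:R / p%:R)) (sin (2 * pi * n%:R / p%:R)).
Proof.
elim: n => [|n IHn]; first by rewrite expr0 mulr0 mul0r cos0 sin0.
have e : 2 * pi * n.+1%:R / p%:R = 2 * pi * n%:R / p%:R + 2 * pi / p%:R :> R.
  by rewrite -(natr1 n) mulrDr mulr1 mulrDl.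
rewrite exprSr IHn /zeta e cosD sinD.
by simpc; rewrite [X in Complex _ X]addrC.
Qed.

Lemma chiE (u : 'F_p) : chi R u = zeta ^+ u.
Proof. by rewrite zetaX. Qed.

Lemma zeta_neq1 : zeta != 1.
Proof.
apply/eqP => -[c1 s0].
have p0 : (0 : R) < p%:R by rewrite ltr0n prime_gt0.
have pi0 := pi_gt0 R.
have [p2|p3] := eqVneq p 2%N.
  move: c1; rewrite p2 mulrAC mulfV ?pnatr_eq0 // mul1r cospi; lra.
have : 0 < sin (2 * pi / p%:R : R).
  apply: sin_gt0_pi; rewrite divr_gt0 ?mulr_gt0 //=.
  rewrite ltr_pdivrMr // mulrC ltr_pM2l // ltr_nat.
  by have := prime_gt1 p_prime; lia.
by rewrite s0 ltxx.
Qed.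

Lemma prim_zeta : p.-primitive_root zeta.
Proof.
have zp : zeta ^+ p = 1.
  have p0 : (p%:R : R) != 0 by rewrite pnatr_eq0 -lt0n prime_gt0.
  by rewrite zetaX mulfK // mulr_natl cos2pi sin2pi.
have [m zm mp] := prim_order_exists (prime_gt0 p_prime) zp.
have := (primeP p_prime).2 _ mp => /pred2P[] m_eq; last by rewrite -m_eq.
have := zeta_neq1; rewrite -[zeta]expr1 -m_eq (prim_expr_order zm); by rewrite eqxx.
Qed.

Lemma chiD (u v : 'F_p) : chi R (u + v) = chi R u * chi R v.
Proof.
(* Elements of 'F_p are bounded by an expression that equals p but does not
   reduce to it, so the modulus is changed with the index k generalized. *)
have modF k : (k %% (Zp_trunc (pdiv p)).+2 = k %% p)%N by rewrite Fp_cast.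
by rewrite !chiE -exprD /= modF (prim_expr_mod prim_zeta).
Qed.

Lemma chi0 : chi R (0 : 'F_p) = 1.
Proof. by rewrite chiE expr0. Qed.

Lemma chi_eq1 (u : 'F_p) : (chi R u == 1) = (u == 0).
Proof.
rewrite chiE -(prim_order_dvd prim_zeta).
have up : (u < p)%N by rewrite -{2}(Fp_cast p_prime).
apply/idP/eqP => [|->]; last by rewrite dvdn0.
by rewrite /dvdn modn_small // => /eqP u0; apply: val_inj.
Qed.

Lemma chi_conj (u : 'F_p) : Num.conj (chi R u) = chi R (- u).
Proof.
have nz : chi R u * chi R (- u) = 1 by rewrite -chiD subrr chi0.
have n1 : chi R u * Num.conj (chi R u) = 1.
  by rewrite /chi; simpc; rewrite -!expr2 cos2Dsin2 mulrC addNr.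
have u0 : chi R u != 0.
  by apply: contra_eq_neq n1 => ->; rewrite mul0r eq_sym oner_eq0.
by apply: (mulfI u0); rewrite n1 nz.
Qed.

(** The powers of zeta satisfy no rational relation other than the vanishing of
    their sum, because Phi = 1 + X + ... + X^(p-1) is irreducible over Q.  The
    irreducibility is read off the minimal polynomial of a primitive p-th root
    of unity in algC; it then applies to zeta, which lives in another field,
    since gcd(Phi, q) is computed over Q and has zeta as a root. *)
Lemma rational_relation (c : 'F_p -> nat) :
  \sum_t (c t)%:R * chi R t = 0 -> forall s t, c s = c t.
Proof.
pose Phi : {poly rat} := \sum_(i < p) 'X^i.
have PhiE : Phi = \poly_(i < p) 1.
  by rewrite poly_def; apply: eq_bigr => i _; rewrite scale1r.
have szPhi : size Phi = p.
  by rewrite PhiE size_poly_eq // oner_eq0.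
have Phi0 : Phi != 0 by rewrite -size_poly_eq0 szPhi -lt0n prime_gt0.
have rootPhi (K : numFieldType) (z : K) : p.-primitive_root z ->
    root (map_poly ratr Phi) z.
  move=> zP.
  have z1 : z - 1 != 0.
    rewrite subr_eq0; apply: contraTneq zP => ->.
    apply/negP => P1.
    have := prim_order_dvd P1 1; rewrite expr1 eqxx dvdn1 => /eqP p1.
    by have := prime_gt1 p_prime; rewrite p1.
  rewrite /root rmorph_sum /= horner_sum; apply/eqP/(mulfI z1).
  have <- : z ^+ p - 1 = (z - 1) * 0.
    by rewrite mulr0 (prim_expr_order zP) subrr.
  rewrite subrX1.
  congr (_ * _); apply: eq_bigr => i _.
  by rewrite map_polyXn hornerXn.
(* Phi is irreducible: it is, up to a unit, the minimal polynomial m of a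
   primitive root w in algC, and w is a root of one of any two factors. *)
have irrPhi (g : {poly rat}) : g %| Phi -> (1 < size g)%N -> Phi %| g.
  have [w wP] := C_prim_root_exists (prime_gt0 p_prime).
  have [m [minE _] min_dvd] := minCpolyP w.
  have szm : size m = p.
    rewrite -(size_map_poly (ratr : rat -> algC)) -minE.
    rewrite (minCpoly_cyclotomic wP) size_cyclotomic totient_prime //.
    by rewrite prednK ?prime_gt0.
  have mPhi : m %= Phi.
    rewrite -dvdp_size_eqp; first by rewrite szm szPhi.
    by rewrite -min_dvd; apply: rootPhi.
  move=> gPhi gt1.
  have [h PhiEq] : exists h : {poly rat}, Phi = h * g by apply/dvdpP.
  rewrite -(eqp_dvdl _ mPhi) -min_dvd.
  have := rootPhi _ _ wP; rewrite PhiEq rmorphM rootM => /orP[|//].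
  move=> rh; have mh : m %| h by rewrite -min_dvd.
  have h0 : h != 0 by apply: contraNneq Phi0 => h0; rewrite PhiEq h0 mul0r.
  have g0 : g != 0 by rewrite -size_poly_gt0; lia.
  exfalso; have := dvdp_leq h0 mh.
  have := szPhi; rewrite PhiEq size_mul // szm.
  by move: gt1; move: (size g) (size h) => a b; lia.
move=> sum0.
pose q : {poly rat} := \sum_t (c t)%:R *: 'X^(nat_of_ord t).
have qE t : q`_(nat_of_ord t) = (c t)%:R.
  rewrite coef_sum (bigD1 t) //= coefZ coefXn eqxx mulr1 big1 ?addr0 //.
  move=> i it; rewrite coefZ coefXn.
  by rewrite eq_sym (inj_eq val_inj) (negbTE it) mulr0.
have szq : (size q <= p)%N.
  apply: (leq_trans (size_sum _ _ _)); apply/bigmax_leqP => t _.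
  apply: (leq_trans (size_scale_leq _ _)); rewrite size_polyXn.
  by rewrite -[p in (_ <= p)%N](Fp_cast p_prime).
have rootq : root (map_poly ratr q) (zeta).
  rewrite /root rmorph_sum /= horner_sum; apply/eqP.
  apply: etrans sum0; apply: eq_bigr => t _.
  by rewrite linearZ /= hornerZ map_polyXn hornerXn chiE ratr_nat.
have Phig : Phi %| gcdp Phi q.
  apply: irrPhi; first exact: dvdp_gcdl.
  rewrite -(size_map_poly (ratr : rat -> R[i])) gcdp_map.
  apply: (@root_size_gt1 _ zeta); last by rewrite root_gcd rootq rootPhi ?prim_zeta.
  by rewrite -gcdp_map map_poly_eq0 gcdp_eq0 negb_and Phi0.
have [h qEh] : exists h : {poly rat}, q = h * Phi.
  by apply/dvdpP/(dvdp_trans Phig)/dvdp_gcdr.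
(* Both q and Phi have degree less than p, so their quotient is constant. *)
have [k hk] : exists k, h = k%:P.
  have [->|h0] := eqVneq h 0; first by exists 0.
  exists h`_0; apply: size1_polyC.
  move: szq; rewrite qEh size_mul // szPhi.
  by have := prime_gt0 p_prime; move: (size h) => a; lia.
have ck t : (c t)%:R = k.
  rewrite -qE qEh hk mul_polyC coefZ PhiE coef_poly.
  by rewrite -[p in (_ < p)%N](Fp_cast p_prime) ltn_ord mulr1.
by move=> s t; apply/eqP; rewrite -(eqr_nat rat) !ck.
Qed.
End RootOfUnity.

(** * The dot product *)

Section DotProduct.
Variables (p d : nat).
Local Notation Zpd := 'rV['F_p]_d.
Implicit Types x y u v : Zpd.

Lemma dotC x y : dot x y = dot y x.
Proof. by apply: eq_bigr => i _; rewrite mulrC. Qed.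

Lemma dotDl x y u : dot (x + y) u = dot x u + dot y u.
Proof. by rewrite /dot -big_split; apply: eq_bigr => i _; rewrite mxE mulrDl. Qed.

Lemma dotZl c x u : dot (c *: x) u = c * dot x u.
Proof. by rewrite /dot mulr_sumr; apply: eq_bigr => i _; rewrite mxE mulrA. Qed.

Lemma dotBl x y u : dot (x - y) u = dot x u - dot y u.
Proof. by rewrite dotDl -scaleN1r dotZl mulN1r. Qed.

Lemma dotDr u x y : dot u (x + y) = dot u x + dot u y.
Proof. by rewrite !(dotC u) dotDl. Qed.

Lemma dotBr u x y : dot u (x - y) = dot u x - dot u y.
Proof. by rewrite !(dotC u) dotBl. Qed.

Lemma dotZr c u x : dot u (c *: x) = c * dot u x.
Proof. by rewrite !(dotC u) dotZl. Qed.

Lemma dot0l u : dot 0 u = 0.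
Proof. by rewrite -(scale0r 0) dotZl mul0r. Qed.

Lemma dot0r u : dot u 0 = 0.
Proof. by rewrite dotC dot0l. Qed.

Lemma dot_nondegenerate u : u != 0 -> exists y, dot y u != 0.
Proof.
move=> u0; have [i ui] : exists i, u 0 i != 0.
  apply/existsP; apply: contraNT u0 => /existsPn u0; apply/eqP/rowP => i.
  by rewrite mxE; apply/eqP/negbNE/u0.
exists (delta_mx 0 i); rewrite /dot (bigD1 i) //= big1 => [|j ji].
  by rewrite mxE !eqxx mul1r addr0.
by rewrite mxE (negbTE ji) andbF mul0r.
Qed.

Lemma card_Zpd : prime p -> #|Zpd| = (p ^ d)%N.
Proof. by move=> p_pr; rewrite card_mx card_Fp // mul1n. Qed.
End DotProduct.

(** * Tilings of a finite abelian group *)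

Section Tilings.
Variable G : finZmodType.
Implicit Types E A : {set G}.

Lemma subr_exchange (a b c e : G) : a + b = c + e -> a - c = e - b.
Proof.
by move=> sum_eq; apply/eqP; rewrite subr_eq addrAC eq_sym subr_eq addrC -sum_eq.
Qed.

Lemma addr_subKl (a b : G) : a + b - a = b.
Proof. by rewrite addrAC subrr add0r. Qed.

Lemma imset_add_setT E A :
  {in setX E A &, injective (fun ea : G * G => ea.1 + ea.2)} ->
  (#|E| * #|A| = #|G|)%N -> [set ea.1 + ea.2 | ea in setX E A] = setT.
Proof.
move=> inj cardEA; apply/eqP; rewrite eqEcard subsetT cardsT card_in_imset //.
by rewrite cardsX cardEA leqnn.
Qed.

(** In a finite group, surjectivity of the addition E x A -> G can be traded for
    a count, which is how every tiling below is established. *)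
Lemma tiles_withP E A : tiles_with E A <->
  {in setX E A &, injective (fun ea : G * G => ea.1 + ea.2)} /\
  (#|E| * #|A| = #|G|)%N.
Proof.
set add := fun ea : G * G => ea.1 + ea.2.
split=> [tEA|[inj cardEA] x].
  have inj : {in setX E A &, injective add}.
    move=> [e a] [e' a'] /setXP[/= eE aA] /setXP[/= e'E a'A] sum_eq.
    have [ea [_ uniq_ea]] := tEA (e + a).
    by rewrite -(uniq_ea (e, a)) // -(uniq_ea (e', a')).
  split=> //; rewrite -cardsX -(card_in_imset inj) -cardsT; congr #|pred_of_set _|.
  apply/setP => x; rewrite inE; apply/imsetP.
  have [[e a] [[/= eE aA xE] _]] := tEA x.
  by exists (e, a); rewrite // inE eE.
have /setP/(_ x) := imset_add_setT inj cardEA.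
rewrite inE => /imsetP[[e a] eaEA xE]; exists (e, a); split=> [|[e' a']].
  by move: eaEA => /setXP[].
move=> [/= e'E a'A xE']; apply: inj => //; first by rewrite inE e'E.
exact: etrans (esym xE) xE'.
Qed.

Lemma tiles_with_setT (x : G) : tiles_with [set x] setT.
Proof.
apply/tiles_withP; split; last by rewrite cards1 cardsT mul1n.
move=> [e a] [e' a'] /setXP[/set1P /= -> _] /setXP[/set1P /= -> _].
by move/addrI => ->.
Qed.

Lemma tiles_with_sum (M : nmodType) (F : G -> M) E A : tiles_with E A ->
  \sum_x F x = \sum_(e in E) \sum_(a in A) F (e + a).
Proof.
case/tiles_withP => inj cardEA; have sumT := imset_add_setT inj cardEA.
transitivity (\sum_(x in [set ea.1 + ea.2 | ea in setX E A]) F x).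
  by apply: eq_bigl => x; rewrite sumT inE.
rewrite big_imset //= pair_big /=.
by apply: eq_bigl => -[e a]; rewrite inE.
Qed.

Lemma tiles_with_card E A : tiles_with E A -> (#|E| * #|A| = #|G|)%N.
Proof. by case/tiles_withP. Qed.
End Tilings.

(** * Balanced directions, orthogonality and spectra *)

Section Balanced.
Variables (R : realType) (p d : nat).
Hypothesis p_prime : prime p.
Local Notation Zpd := 'rV['F_p]_d.
Local Notation C := R[i].
Implicit Types (E A B : {set Zpd}) (u v x y : Zpd).

Definition slice E u (t : 'F_p) : {set Zpd} := [set e in E | dot e u == t].

(** The multiplicative form avoids dividing by p.  By [balancedP] below this is
    the vanishing at u of the Fourier transform of the indicator of E. *)
Definition balanced E u : bool := [forall t, (#|slice E u t| * p == #|E|)%N].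

(** Translating by y preserves the sum but multiplies it by chi (g y), which
    differs from 1. *)
Lemma sum_chi_eq0 (G : finZmodType) (H : {set G}) (g : G -> 'F_p) (y : G) :
  (forall x : G, (x + y \in H) = (x \in H)) -> (forall x : G, g (x + y) = g x + g y) ->
  g y != 0 -> \sum_(x in H) chi R (g x) = 0.
Proof.
move=> Hy gD gy; set S := \sum_(_ in _) _.
have : S = S * chi R (g y).
  rewrite {1}/S (reindex_inj (addIr y)) mulr_suml.
  by apply: eq_big => // x _; rewrite gD chiD.
move/eqP; rewrite -{1}[S]mulr1 -subr_eq0 -mulrBr mulf_eq0 subr_eq0 [1 == _]eq_sym.
by rewrite (chi_eq1 R p_prime) (negbTE gy) orbF => /eqP.
Qed.

Lemma sum_chi_all (G : finZmodType) (g : G -> 'F_p) (y : G) :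
  (forall x : G, g (x + y) = g x + g y) -> g y != 0 ->
  \sum_(x : G) chi R (g x) = 0.
Proof.
move=> gD gy; rewrite -[RHS](@sum_chi_eq0 G setT g y) // => [|x].
  by apply: eq_bigl => x; rewrite inE.
by rewrite !inE.
Qed.

Lemma sum_chi_slices E u :
  \sum_(e in E) chi R (dot e u) = \sum_t #|slice E u t|%:R * chi R t.
Proof.
rewrite (partition_big (fun e => dot e u) xpredT) //=; apply: eq_bigr => t _.
rewrite mulr_natl -sumr_const; apply: eq_big => [e|e /andP[_ /eqP ->]] //.
by rewrite inE.
Qed.

Lemma sum_card_slices E u : (\sum_t #|slice E u t| = #|E|)%N.
Proof.
rewrite -sum1_card (partition_big (fun e => dot e u) xpredT) //=.
by apply: eq_bigr => t _; rewrite -sum1_card; apply: eq_bigl => e; rewrite inE.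
Qed.

(** One direction is the irreducibility of the cyclotomic polynomial; the other
    is the vanishing of the sum of chi over Z_p. *)
Lemma balancedP E u :
  reflect (\sum_(e in E) chi R (dot e u) = 0) (balanced E u).
Proof.
rewrite sum_chi_slices; apply: (iffP forallP) => [bal|sum0 t].
  have cst t : #|slice E u t| = (#|E| %/ p)%N.
    by rewrite -(eqP (bal t)) mulnK ?prime_gt0.
  under eq_bigr do rewrite cst.
  by rewrite -mulr_sumr (@sum_chi_all _ id 1) ?mulr0 ?oner_eq0.
have cst s := rational_relation p_prime sum0 s t.
rewrite -(sum_card_slices E u); under [X in _ == X]eq_bigr do rewrite cst.
by rewrite sum_nat_const card_Fp // mulnC.
Qed.

Lemma balanced_scale E u (c : 'F_p) : c != 0 -> balanced E u -> balanced E (c *: u).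
Proof.
move=> c0 /forallP bal; apply/forallP => t.
suff -> : slice E (c *: u) t = slice E u (t / c) by [].
by apply/setP => e; rewrite !inE dotZr mulrC (can2_eq (mulfK c0) (mulfVK c0)).
Qed.

Lemma balanced_dvd E u : balanced E u -> (p %| #|E|)%N.
Proof. by move=> /forallP/(_ 0)/eqP <-; rewrite dvdn_mull. Qed.

(** The exponential sum over the whole space is 0 and factors, through the
    tiling, as the sum over E times the sum over A. *)
Lemma tiles_with_balanced E A u : tiles_with E A -> u != 0 ->
  balanced E u \/ balanced A u.
Proof.
move=> tEA u0; have [y yu] := dot_nondegenerate u0.
have : \sum_(x : Zpd) chi R (dot x u) = 0.
  by apply: (sum_chi_all (y := y)) => // x; rewrite dotDl.
rewrite (tiles_with_sum _ tEA) => sum0.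
have : (\sum_(e in E) chi R (dot e u)) * (\sum_(a in A) chi R (dot a u)) = 0.
  rewrite -[RHS]sum0 big_distrlr /=; apply: eq_bigr => e _.
  by apply: eq_bigr => a _; rewrite dotDl chiD.
by move/eqP; rewrite mulf_eq0 => /orP[] /eqP/balancedP; [left|right].
Qed.

(** Orthogonality on L^2(E) of the characters indexed by B, as the inner product
    of those of b and c is the exponential sum of E at b - c ([inner_charE]). *)
Definition orthogonal_on E B := {in B &, forall b c, b != c -> balanced E (b - c)}.

Lemma inner_charE E b c : inner (char_on R E b) (char_on R E c) =
  \sum_(e in E) chi R (dot e (b - c)).
Proof.
rewrite [RHS]big_sub; apply: eq_bigr => e _.
by rewrite !ffunE chi_conj // -chiD // dotBr !(dotC _ (val e)).
Qed.

Lemma inner_char_diag E b : inner (char_on R E b) (char_on R E b) = #|E|%:R.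
Proof.
rewrite inner_charE subrr; under eq_bigr do rewrite dot0r chi0.
by rewrite sumr_const.
Qed.

Lemma dim_L2 E : \dim (fullv : {vspace L2 R E}) = #|E|.
Proof. by rewrite dimvf /= /dim /= muln1 card_sig. Qed.

Lemma orthogonal_free E B : E != set0 -> orthogonal_on E B ->
  free [seq (char_on R E b : L2 R E) | b <- enum B].
Proof.
move=> E0 orth; set X := [seq _ | _ <- _].
have szX : size X = #|B| by rewrite size_map -cardE.
have nthX (i : 'I_#|B|) : X`_i = char_on R E (enum_val i).
  by rewrite (nth_map (enum_val i)) -?cardE // -enum_val_nth.
suff : free (Tuple (introT eqP szX)) by [].
apply/freeP => k /= sum0 j.
have : inner (\sum_(i < #|B|) k i *: X`_i) (char_on R E (enum_val j)) = 0.
  by rewrite sum0 /inner big1 // => e _; rewrite ffunE mul0r.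
have -> : inner (\sum_(i < #|B|) k i *: X`_i) (char_on R E (enum_val j)) =
    \sum_(i < #|B|) k i * inner (char_on R E (enum_val i)) (char_on R E (enum_val j)).
  rewrite /inner; under [RHS]eq_bigr do rewrite mulr_sumr.
  rewrite exchange_big /=; apply: eq_bigr => e _.
  rewrite sum_ffunE mulr_suml; apply: eq_bigr => i _.
  by rewrite nthX ffunE mulrA.
rewrite (bigD1 j) //= big1 ?addr0 => [|i ij].
  rewrite inner_char_diag => /eqP; rewrite mulf_eq0 pnatr_eq0 cards_eq0.
  by rewrite (negbTE E0) orbF => /eqP.
rewrite inner_charE; suff /balancedP -> : balanced E (enum_val i - enum_val j).
  by rewrite mulr0.
by apply: orth; rewrite ?enum_valP // (inj_eq enum_val_inj).
Qed.

(** Orthogonal nonzero vectors are linearly independent, and L^2(E) has dimension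
    #|E|. *)
Lemma orthogonal_card E B : E != set0 -> orthogonal_on E B -> (#|B| <= #|E|)%N.
Proof.
move=> E0 orth; have /eqnP := orthogonal_free E0 orth.
rewrite size_map -cardE -(dim_L2 E) => <-; exact/dimvS/subvf.
Qed.

Lemma spectral_withP E B : E != set0 ->
  (spectral_with R E B <-> #|B| = #|E| /\ orthogonal_on E B).
Proof.
move=> E0; split=> [[orth]|[cardB orth]].
  rewrite basisEdim dim_L2 size_map -cardE => /andP[fullX leBE].
  have orthB : orthogonal_on E B.
    move=> b c bB cB bc; apply/balancedP; rewrite -inner_charE; exact: orth.
  split=> //; apply/eqP; rewrite eqn_leq leBE -(dim_L2 E).
  rewrite (leq_trans (dimvS fullX)) // (leq_trans (dim_span _)) //.
  by rewrite size_map -cardE.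
split=> [b c bB cB bc|]; first by rewrite inner_charE; apply/balancedP/orth.
by rewrite basisEfree orthogonal_free //= subvf dim_L2 size_map -cardE cardB leqnn.
Qed.

Lemma mulmx1C_cast (K : fieldType) m n (M : 'M[K]_(m, n)) (N : 'M_(n, m)) :
  m = n -> M *m N = 1%:M -> N *m M = 1%:M.
Proof. by move=> mn; case: _ / mn N M => N M; apply: mulmx1C. Qed.

(** The character matrix with rows indexed by B and columns by E has orthogonal
    rows of squared norm #|E|; being square, it has orthogonal columns too. *)
Lemma orthogonal_dual E B : E != set0 -> #|B| = #|E| ->
  orthogonal_on E B -> orthogonal_on B E.
Proof.
move=> E0 cardB orth e e' eE e'E ee'.
have nE0 : (#|E|%:R : C) != 0 by rewrite pnatr_eq0 cards_eq0.
(* N is the conjugate transpose of M, scaled to be its inverse. *)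
pose M : 'M[C]_(#|B|, #|E|) := \matrix_(i, j) chi R (dot (enum_val j) (enum_val i)).
pose N : 'M[C]_(#|E|, #|B|) :=
  \matrix_(j, i) (#|E|%:R^-1 * chi R (- dot (enum_val j) (enum_val i))).
have MN : M *m N = 1%:M.
  apply/matrixP => i k; rewrite !mxE.
  transitivity (#|E|%:R^-1 *
      \sum_(x in E) chi R (dot x (enum_val i - enum_val k))).
    rewrite mulr_sumr [RHS]big_enum_val; apply: eq_bigr => j _.
    by rewrite !mxE mulrCA -chiD // dotBr.
  have [->|ik] := eqVneq i k.
    rewrite subrr; under eq_bigr do rewrite dot0r chi0.
    by rewrite sumr_const mulVf.
  suff /balancedP -> : balanced E (enum_val i - enum_val k) by rewrite mulr0.
  by apply: orth; rewrite ?enum_valP // (inj_eq enum_val_inj).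
have /matrixP NM := mulmx1C_cast cardB MN.
apply/balancedP; have := NM (enum_rank_in e'E e') (enum_rank_in e'E e).
rewrite !mxE (inj_in_eq (can_in_inj (enum_rankK_in e'E))) // eq_sym (negbTE ee') /=.
move=> sum0; apply: (mulfI (invr_neq0 nE0)); rewrite mulr0 -[RHS]sum0.
rewrite mulr_sumr big_enum_val; apply: eq_bigr => i _.
rewrite !mxE !enum_rankK_in // -mulrA -chiD //.
by rewrite dotBr addrC !(dotC (enum_val i)).
Qed.

(** Such an E carries all p^d characters as an orthogonal family, so it has at
    least p^d elements: this replaces Fourier inversion. *)
Lemma balanced_all_setT E : E != set0 ->
  (forall u, u != 0 -> balanced E u) -> E = setT.
Proof.
move=> E0 bal; apply/eqP; rewrite eqEcard subsetT /=.
by apply: orthogonal_card => // b c _ _ bc; apply: bal; rewrite subr_eq0.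
Qed.

(** Count the double sum of chi (x . v) over all x and all v in V: the sum over v
    is #|V| on V^perp and 0 elsewhere, the sum over x is p^d for v = 0 and 0
    otherwise. *)
Lemma card_perp (V : {vspace Zpd}) : (#|vset V| * #|perp V| = p ^ d)%N.
Proof.
apply/eqP; rewrite -(eqr_nat C) natrM; apply/eqP.
transitivity (\sum_(x : Zpd) \sum_(v in vset V) chi R (dot x v)); last first.
  rewrite exchange_big /= (bigD1 0) ?inE ?mem0v //= [X in _ + X]big1.
    under eq_bigr do rewrite dot0r chi0.
    by rewrite sumr_const addr0 card_Zpd.
  move=> v /andP[_ v0]; have [y yv] := dot_nondegenerate v0.
  by apply: (sum_chi_all (y := y)) => // x; rewrite dotDl.
rewrite (bigID (mem (perp V))) /= [X in _ = _ + X]big1 => [|x].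
  rewrite addr0 mulr_natr -sumr_const; apply: eq_bigr => x.
  rewrite inE => /forall_inP xV; rewrite -sumr_const; apply: eq_bigr => v vV.
  by rewrite (eqP (xV v vV)) chi0.
rewrite inE => /forall_inPn[y yV xy].
apply: (sum_chi_eq0 (y := y)) => // v; rewrite ?dotDr // !inE.
by rewrite rpredDr //; move: yV; rewrite inE.
Qed.
End Balanced.

(** * Determined directions and subspaces as tiling partners *)

Section Subspaces.
Variables (R : realType) (p d : nat).
Hypothesis p_prime : prime p.
Local Notation Zpd := 'rV['F_p]_d.
Implicit Types (E A B H : {set Zpd}) (u v w x y : Zpd) (V W : {vspace Zpd}).

(** The directions determined by B, as in the theory of direction sets: only the
    line spanned by u matters, and u = 0 is never determined. *)
Definition determines B u : bool :=
  [exists b in B, exists c in B, (b != c) && (b - c \in <[u]>%VS)].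

Lemma card_line u : u != 0 -> #|vset <[u]>| = p.
Proof.
move=> u0; rewrite -[RHS](card_Fp p_prime) -cardsT.
have inj : injective (fun c : 'F_p => c *: u).
  move=> c c' /eqP; rewrite -subr_eq0 -scalerBl scaler_eq0 (negbTE u0) orbF.
  by rewrite subr_eq0 => /eqP.
rewrite -(card_imset _ inj); apply: eq_card => x; rewrite inE.
by apply/vlineP/imsetP => -[c]; [exists c | move=> _ ->; exists c].
Qed.

(** A spectrum needs only one pair of points in a direction, since balance
    does not depend on the scale of u. *)
Lemma determines_balanced E B u : orthogonal_on E B -> u != 0 ->
  determines B u -> balanced E u.
Proof.
move=> orth u0 /exists_inP[b bB /exists_inP[c cB /andP[bc /vlineP[k bcE]]]].
have k0 : k != 0.
  by apply: contraNneq bc => k0; rewrite -subr_eq0 bcE k0 scale0r.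
rewrite -[u](scalerK k0) -bcE; apply: balanced_scale; last exact: orth.
by rewrite invr_eq0.
Qed.

(** A direction missed by B makes the translates of the line by B disjoint;
    this gives both the pigeonhole bound and the tilings by lines. *)
Lemma undetermined_injective B u : ~~ determines B u ->
  {in setX B (vset <[u]>) &, injective (fun bl : Zpd * Zpd => bl.1 + bl.2)}.
Proof.
move=> /exists_inPn ndet [b l] [c m] /setXP[/= bB]; rewrite inE => lu.
move=> /setXP[/= cB]; rewrite inE => mu sum_eq.
suff bc : b = c by move: sum_eq; rewrite bc => /addrI ->.
apply/eqP; move/exists_inPn: (ndet b bB) => /(_ c cB); apply: contraNT => -> /=.
by rewrite (subr_exchange sum_eq) rpredB.
Qed.

Lemma undetermined_card B u : u != 0 -> ~~ determines B u ->
  (#|B| * p <= p ^ d)%N.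
Proof.
move=> u0 /undetermined_injective inj; rewrite -(card_Zpd d p_prime).
have := max_card [in (fun bl : Zpd * Zpd => bl.1 + bl.2) @: setX B (vset <[u]>)].
by rewrite card_in_imset // cardsX card_line.
Qed.

Lemma undetermined_tiles B u : u != 0 -> ~~ determines B u ->
  (#|B| * p = p ^ d)%N -> tiles_with B (vset <[u]>).
Proof.
move=> u0 /undetermined_injective inj cardB; apply/tiles_withP; split=> //.
by rewrite card_line // cardB -(card_Zpd d p_prime).
Qed.

Lemma orthogonal_determines_setT E B : E != set0 -> orthogonal_on E B ->
  (forall u, u != 0 -> determines B u) -> E = setT.
Proof.
move=> E0 orth det; apply: (balanced_all_setT R) => // u u0.
exact: determines_balanced orth u0 (det u u0).
Qed.

Lemma constant_not_balanced H u (t : 'F_p) : H != set0 ->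
  {in H, forall h, dot h u = t} -> ~~ balanced H u.
Proof.
move=> H0 cst; apply/forallPn; exists t.
have -> : slice H u t = H.
  apply/setP => h; rewrite inE; apply: andb_idr => hH; exact/eqP/cst.
rewrite -{2}[#|H|]muln1 eqn_pmul2l ?card_gt0 //.
by rewrite gtn_eqF ?prime_gt1.
Qed.

Lemma orthogonal_space u : exists V, forall x, (x \in V) = (dot x u == 0).
Proof.
exists (lker (linfun (mulmxr u^T) : 'Hom(Zpd, 'M['F_p]_1))) => x.
rewrite memv_ker lfunE /=; have -> : dot x u = (x *m u^T) 0 0.
  by rewrite mxE; apply: eq_bigr => i _; rewrite mxE.
apply/eqP/eqP => [->|x0]; first by rewrite mxE.
by apply/matrixP => i j; rewrite !ord1 x0 mxE.
Qed.

Lemma vset_neq0 V : vset V != set0.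
Proof. by apply/set0Pn; exists 0; rewrite inE mem0v. Qed.

(** Each hyperplane orthogonal to u contains exactly one point of E, and is a
    translate of the space orthogonal to u. *)
Lemma balanced_size_p E u : #|E| = p -> balanced E u ->
  exists V, tiles_with E (vset V).
Proof.
move=> cardE /forallP bal; have [V VE] := orthogonal_space u; exists V => x.
have /cards1P[e eE] : #|slice E u (dot x u)| == 1%N.
  rewrite -(eqn_pmul2r (prime_gt0 p_prime)) mul1n; apply/eqP.
  by rewrite -[RHS]cardE; apply/eqP/bal.
have : e \in slice E u (dot x u) by rewrite eE set11.
rewrite inE => /andP[eiE /eqP ex]; exists (e, x - e); split.
  split=> //=; first by rewrite inE VE dotBl ex subrr.
  by rewrite addrC subrK.
move=> [e' v] [/= e'E]; rewrite inE VE => /eqP v0 xE.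
have /set1P e'e : e' \in [set e] by rewrite -eE inE e'E xE dotDl v0 addr0 /=.
by rewrite e'e in xE *; rewrite xE addrAC subrr add0r.
Qed.

(** Both directions use that a set on which a linear form is constant is not
    balanced along it.  If E tiles with V, this leaves E balanced along
    V^perp.  If E has spectrum V^perp, then by duality V^perp is balanced along
    all differences of E, so none of them lies in V. *)
Lemma tiles_subspace_spectral E V : E != set0 ->
  (tiles_with E (vset V) <-> spectral_with R E (perp V)).
Proof.
move=> E0; have cardV := card_perp R p_prime V.
have V_gt0 : (0 < #|vset V|)%N by rewrite card_gt0 vset_neq0.
split=> [tEV|].
  apply/spectral_withP => //; split.
    have := tiles_with_card tEV; rewrite [X in _ = X](card_Zpd d p_prime) -cardV.
    by rewrite mulnC => /eqP; rewrite eqn_pmul2l // => /eqP.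
  move=> b c; rewrite !inE => /forall_inP bV /forall_inP cV bc.
  have := tiles_with_balanced R p_prime tEV; move=> /(_ (b - c)).
  rewrite subr_eq0 => /(_ bc)[//|]; apply: contraTT => _.
  apply: (constant_not_balanced (t := 0)); first exact: vset_neq0.
  move=> v vV; rewrite dotC dotBl.
  by rewrite (eqP (bV v vV)) (eqP (cV v vV)) subrr.
move=> /(spectral_withP _ p_prime _ E0)[cardP orth].
have dual := orthogonal_dual R p_prime E0 cardP orth.
apply/tiles_withP; split; last first.
  by rewrite -cardP mulnC cardV -(card_Zpd d p_prime).
move=> [e v] [e' v'] /setXP[/= eE]; rewrite inE => vV.
move=> /setXP[/= e'E]; rewrite inE => v'V sum_eq.
suff ee' : e = e' by move: sum_eq; rewrite ee' => /addrI ->.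
apply/eqP; apply: contraT => ee'; have := dual e e' eE e'E ee'.
apply: contraTT => _; apply: (constant_not_balanced (t := 0)).
  by apply/set0Pn; exists 0; rewrite inE; apply/forall_inP => x _; rewrite dot0l.
have eV : e - e' \in vset V by rewrite inE (subr_exchange sum_eq) rpredB.
by move=> b; rewrite inE => /forall_inP/(_ _ eV)/eqP.
Qed.

Lemma complementary_decomposition V W x : complementary W V ->
  exists2 w, w \in W & x - w \in V.
Proof.
move=> [WV _]; have : x \in (W + V)%VS by rewrite WV memvf.
by case/memv_addP => w wW [v vV ->]; exists w; rewrite // addrAC subrr add0r.
Qed.

Lemma complementary_cancel V W w w' v v' : complementary W V ->
  w \in W -> w' \in W -> v \in V -> v' \in V -> w + v = w' + v' -> w = w'.
Proof.
move=> [_ WV] wW w'W vV v'V sum_eq; apply/eqP; rewrite -subr_eq0 -memv0 -WV.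
by rewrite memv_cap rpredB //= (subr_exchange sum_eq) rpredB.
Qed.

(** E tiles with V when it has one point in each coset of V, and a complement W
    of V has one point in each coset as well: the function sends the latter to
    the displacement leading to the former. *)
Lemma tiles_subspace_graph E V : tiles_with E (vset V) <->
  exists W, complementary W V /\ graph_over E W V.
Proof.
split=> [tEV|[W [compl [f [fV ->]]]]] .
  have compl : complementary (V^C)%VS V.
    by split; rewrite ?[(V^C :&: _)%VS]capvC ?capv_compl // addvC addv_complf.
  exists (V^C)%VS; split=> //.
  have ex x : exists v, (v \in V) && (x + v \in E).
    have [[e v] [[/= eE vV xE] _]] := tEV x; exists (- v).
    by rewrite rpredN xE addrK eE andbT; rewrite inE in vV.
  exists (fun x => xchoose (ex x)); split=> [x _|].
    by case/andP: (xchooseP (ex x)).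
  apply/setP => e; apply/idP/imsetP => [eE|[w _ ->]]; last first.
    by case/andP: (xchooseP (ex w)).
  have [w wW ewV] := complementary_decomposition e compl.
  exists w; rewrite ?inE //; case/andP: (xchooseP (ex w)).
  set v := xchoose _ => vV wvE.
  have [ea [_ uniq_ea]] := tEV w.
  have E1 : ea = (e, w - e).
    apply: uniq_ea; split=> //=; first by rewrite inE -opprB rpredN.
    by rewrite addrC subrK.
  have E2 : ea = (w + v, - v) by apply: uniq_ea; split; rewrite ?inE ?rpredN ?addrK.
  by move: E2; rewrite E1 => -[].
move=> x; have [w wW xwV] := complementary_decomposition x compl.
exists (w + f w, x - (w + f w)); split.
  split=> /=; [by apply/imsetP; exists w; rewrite ?inE | |].
    by rewrite inE opprD addrA rpredB ?fV.
  by rewrite addrC subrK.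
move=> [e v] [/= /imsetP[w']]; rewrite !inE => w'W -> vV xE.
have ww' : w = w'.
  apply: (complementary_cancel compl wW w'W xwV (v' := f w' + v)).
    by rewrite rpredD ?fV.
  by rewrite addrC subrK xE addrA.
by rewrite -ww' in xE *; rewrite xE; congr (_, _); apply: addr_subKl.
Qed.

Lemma tiles_subspace_graph_set E V : tiles_with E (vset V) -> graph_set E.
Proof. by case/tiles_subspace_graph => W [compl gr]; exists W, V. Qed.

Lemma spectral_balanced E : E != set0 -> spectral R E ->
  #|E| = 1%N \/ exists2 u, u != 0 & balanced E u.
Proof.
move=> E0 [B /(spectral_withP _ p_prime _ E0)[cardB orth]].
have [E1|E1] := eqVneq #|E| 1%N; [by left | right].
have : (1 < #|B|)%N by rewrite cardB ltn_neqAle eq_sym E1 card_gt0.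
case/card_gt1P => b [c [bB cB bc]]; exists (b - c); first by rewrite subr_eq0.
exact: orth.
Qed.

(** By pigeonhole the spectrum determines every direction. *)
Lemma spectral_large E : E != set0 -> spectral R E ->
  (p ^ d < #|E| * p)%N -> E = setT.
Proof.
move=> E0 [B /(spectral_withP _ p_prime _ E0)[cardB orth]] large.
apply: (orthogonal_determines_setT E0 orth) => u u0.
by apply: contraTT large => /(undetermined_card u0); rewrite cardB -leqNgt.
Qed.
End Subspaces.

(** * Tiles and spectral sets of special sizes *)

Section SpecialSizes.
Variables (R : realType) (p d : nat).
Hypothesis p_prime : prime p.
Local Notation Zpd := 'rV['F_p]_d.
Implicit Types (E A B H : {set Zpd}) (u v w x y : Zpd) (V W : {vspace Zpd}).

Lemma tiles_card_pow E : tiles E -> exists r, (r <= d)%N /\ #|E| = (p ^ r)%N.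
Proof.
case=> A /tiles_with_card; rewrite [X in _ = X -> _](card_Zpd d p_prime) => cardEA.
have : (#|E| %| p ^ d)%N by rewrite -cardEA dvdn_mulr.
by case/(dvdn_pfactor _ _ p_prime) => r rd ->; exists r.
Qed.

Lemma singleton_tiles_subspace E : #|E| = 1%N -> exists V, tiles_with E (vset V).
Proof.
move=> /eqP/cards1P[e ->]; exists fullv; rewrite (_ : vset fullv = setT).
  exact: tiles_with_setT.
by apply/setP => x; rewrite !inE memvf.
Qed.

Lemma setT_tiles_subspace : exists V, tiles_with [set: Zpd] (vset V).
Proof.
exists 0%VS; apply/tiles_withP; split.
  move=> [e v] [e' v'] /setXP[/= _]; rewrite inE memv0 => /eqP ->.
  by move=> /setXP[/= _]; rewrite inE memv0 => /eqP ->; rewrite !addr0 => ->.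
rewrite cardsT (_ : vset 0 = [set 0]) ?cards1 ?muln1 //.
by apply/setP => x; rewrite !inE memv0.
Qed.

Lemma setT_of_card E : #|E| = (p ^ d)%N -> E = setT.
Proof.
by move=> cardE; apply/eqP; rewrite eqEcard subsetT cardE cardsT card_Zpd /= ?leqnn.
Qed.

(** If E were balanced along no direction, its partner would be balanced along
    all of them, hence be the whole space, forcing #|E| = 1. *)
Lemma tiles_size_p E : #|E| = p -> tiles E -> exists V, tiles_with E (vset V).
Proof.
move=> cardE [A tEA].
have [/existsP[u /andP[_]]|/existsPn unbal] :=
    boolP [exists u, (u != 0) && balanced E u].
  exact: balanced_size_p.
have cardEA := tiles_with_card tEA.
have A0 : A != set0.
  apply: contra_eq_neq cardEA => ->; rewrite cards0 muln0 eq_sym -lt0n.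
  by apply/card_gt0P; exists 0.
have AT : A = setT.
  apply: (balanced_all_setT R p_prime A0) => u u0.
  have [balE|//] := tiles_with_balanced R p_prime tEA u0.
  by have := unbal u; rewrite u0 balE.
have pdgt0 : (0 < p ^ d)%N by rewrite expn_gt0 prime_gt0.
move/eqP: cardEA; rewrite AT cardsT !(card_Zpd d p_prime) -[X in _ == X]mul1n.
rewrite eqn_pmul2r // [X in X == _]cardE => /eqP p1.
by have p_gt1 := prime_gt1 p_prime; exfalso; lia.
Qed.

Lemma spectral_size_p E : #|E| = p -> spectral R E ->
  exists V, tiles_with E (vset V).
Proof.
move=> cardE specE; have p_gt1 := prime_gt1 p_prime.
have E0 : E != set0 by rewrite -card_gt0; lia.
case: (spectral_balanced p_prime E0 specE) => [|[u _]]; first by lia.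
exact: balanced_size_p.
Qed.

(** The partner A has p elements, so along a direction w balanced for A its
    elements have distinct products with w.  This fails for every w orthogonal
    to v = a - a', where a and a' are distinct in A.  Hence E is balanced along
    all of v^perp, which has #|E| elements: it is a spectrum, and the line of v
    a partner. *)
Lemma tiles_codim1 E : (0 < d)%N -> #|E| = (p ^ (d - 1))%N -> tiles E ->
  exists V, tiles_with E (vset V).
Proof.
move=> d0 cardE [A tEA]; have p_gt0 := prime_gt0 p_prime.
have pd : (p ^ d = p ^ (d - 1) * p)%N by rewrite -expnSr; congr (p ^ _)%N; lia.
have pd1_gt0 : (0 < p ^ (d - 1))%N by rewrite expn_gt0 p_gt0.
have cardA : #|A| = p.
  have /eqP := tiles_with_card tEA.
  by rewrite [X in _ == X](card_Zpd d p_prime) cardE pd eqn_pmul2l // => /eqP.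
have : (1 < #|A|)%N by rewrite cardA prime_gt1.
case/card_gt1P => a [a' [aA a'A aa']]; set v := a - a'.
have v0 : v != 0 by rewrite subr_eq0.
have E0 : E != set0 by rewrite -card_gt0 cardE.
exists <[v]>%VS; apply/(tiles_subspace_spectral R p_prime _ E0).
apply/spectral_withP => //; split.
  have /eqP := card_perp R p_prime <[v]>; rewrite card_line // pd mulnC.
  by rewrite eqn_pmul2r // cardE => /eqP.
have vV : v \in vset <[v]> by rewrite inE memv_line.
move=> b c; rewrite !inE => /forall_inP/(_ v vV)/eqP bv /forall_inP/(_ v vV)/eqP cv bc.
have bc0 : b - c != 0 by rewrite subr_eq0.
have [//|/forallP/(_ (dot a (b - c)))] := tiles_with_balanced R p_prime tEA bc0.
rewrite cardA -[X in _ == X]mul1n eqn_pmul2r // => /cards1P[x slx].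
have same : dot a' (b - c) = dot a (b - c).
  apply/eqP; rewrite eq_sym -subr_eq0 -dotBl -/v dotC dotBl bv cv subrr.
  by rewrite eqxx.
have /set1P ax : a \in [set x] by rewrite -slx inE aA eqxx.
have /set1P a'x : a' \in [set x] by rewrite -slx inE a'A same eqxx.
by rewrite ax a'x eqxx in aa'.
Qed.

(** By duality B is orthogonal for the characters of E, so if E determined all
    directions then B would be the whole space, which is too large.  A
    direction missed by E spans a partner. *)
Lemma spectral_codim1 E : (0 < d)%N -> #|E| = (p ^ (d - 1))%N -> spectral R E ->
  exists V, tiles_with E (vset V).
Proof.
move=> d0 cardE [B]; have p_gt1 := prime_gt1 p_prime.
have E0 : E != set0 by rewrite -card_gt0 cardE expn_gt0 prime_gt0.
move=> /(spectral_withP _ p_prime _ E0)[cardB orth].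
have dual := orthogonal_dual R p_prime E0 cardB orth.
have pd : (p ^ (d - 1) * p = p ^ d)%N by rewrite -expnSr; congr (p ^ _)%N; lia.
have [/existsP[u /andP[u0 undet]]|/existsPn det] :=
    boolP [exists u, (u != 0) && ~~ determines E u].
  by exists <[u]>%VS; apply: undetermined_tiles => //; rewrite cardE.
have B0 : B != set0 by rewrite -card_gt0 cardB card_gt0.
have BT : B = setT.
  apply: (orthogonal_determines_setT R p_prime B0 dual) => u u0.
  by have := det u; rewrite u0 negbK.
move: cardB; rewrite BT cardsT (card_Zpd d p_prime) cardE -pd => /eqP.
by rewrite -[X in _ == X]muln1 eqn_pmul2l ?expn_gt0 ?prime_gt0 // gtn_eqF.
Qed.

Lemma tiles_dim_le3 E : (d <= 3)%N -> tiles E -> exists V, tiles_with E (vset V).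
Proof.
move=> d3 tE; have [r [rd cardE]] := tiles_card_pow tE.
have [r0|r0] := posnP r; first by apply: singleton_tiles_subspace; rewrite cardE r0.
have d0 : (0 < d)%N by lia.
have [r_eq1|r_neq1] := eqVneq r 1%N.
  by apply: tiles_size_p => //; rewrite cardE r_eq1 expn1.
have [r_eqd|r_neqd] := eqVneq r d.
  by rewrite (@setT_of_card E) ?cardE ?r_eqd //; apply: setT_tiles_subspace.
by apply: tiles_codim1 => //; rewrite cardE; congr (p ^ _)%N; lia.
Qed.

Lemma spectral_card E : E != set0 -> spectral R E ->
  [\/ #|E| = 1%N, #|E| = (p ^ d)%N
    | exists2 k, (0 < k)%N & #|E| = (k * p)%N /\ (k * p ^ 2 <= p ^ d)%N].
Proof.
move=> E0 specE.
case: (spectral_balanced p_prime E0 specE) => [|[u _ balE]]; first by constructor 1.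
have [large|small] := ltnP (p ^ d)%N (#|E| * p)%N.
  by constructor 2; rewrite (spectral_large p_prime E0 specE large) cardsT card_Zpd.
constructor 3; have /dvdnP[k cardE] := balanced_dvd balE.
exists k; last by rewrite cardE -mulnA in small; rewrite cardE -mulnn.
by move: E0; rewrite -card_gt0 cardE; case: k {cardE}.
Qed.

Lemma spectral_dim_le2 E : (d <= 2)%N -> E != set0 -> spectral R E ->
  exists V, tiles_with E (vset V).
Proof.
move=> d2 E0 specE; have p_gt1 := prime_gt1 p_prime.
case: (spectral_card E0 specE) => [||[k k0 [cardE small]]].
- exact: singleton_tiles_subspace.
- by move/setT_of_card => ->; apply: setT_tiles_subspace.
have pd : (p ^ d <= p ^ 2)%N by rewrite leq_exp2l.
have k1 : k = 1%N.
  have p2_gt0 : (0 < p ^ 2)%N by rewrite expn_gt0 prime_gt0.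
  have : (k * p ^ 2 <= 1 * p ^ 2)%N by rewrite mul1n (leq_trans small).
  by rewrite leq_pmul2r //; lia.
by apply: spectral_size_p => //; rewrite cardE k1 mul1n.
Qed.

Lemma tiles_subspace_spectral_graph E V : E != set0 -> tiles_with E (vset V) ->
  [/\ tiles E, spectral R E & graph_set E].
Proof.
move=> E0 tEV; split; first by exists (vset V).
  by exists (perp V); apply/tiles_subspace_spectral.
exact: tiles_subspace_graph_set tEV.
Qed.

(** Three elements of the spectrum give independent u and v with E balanced
    along u, v and u + v; then the four cells (x . u, x . v) of E have the same
    size. *)
Lemma spectral_char2 E : p = 2%N -> E != set0 -> spectral R E ->
  #|E| = 1%N \/ #|E| = 2%N \/ (4 %| #|E|)%N.
Proof.
move=> p2 E0 [B /(spectral_withP _ p_prime _ E0)[cardB orth]].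
have E_gt0 : (0 < #|E|)%N by rewrite card_gt0.
have [E1|E1] := eqVneq #|E| 1%N; [by left | right].
have [E2|E2] := eqVneq #|E| 2%N; [by left | right].
have : (2 < #|B|)%N by rewrite cardB; lia.
case/card_gt2P => x [y [z [[xB yB zB] [xy yz zx]]]].
pose X := slice E (x - y) 0; pose Y := slice E (y - z) 0.
(* With u = x - y and v = y - z, the form u + v vanishes exactly where u and v
   are both 0 or both 1. *)
have XZ : slice E (x - z) 0 = (X :&: Y) :|: (E :\: (X :|: Y)).
  have F2 (a b : 'F_p) : (a + b == 0) = ((a == 0) == (b == 0)).
    by move: a b; rewrite p2 => -[[|[|]] //= ?] [[|[|]] //= ?].
  apply/setP => e; rewrite !inE.
  have -> : x - z = (x - y) + (y - z) by rewrite addrA subrK.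
  rewrite dotDr F2.
  by case: (e \in E); case: (dot e (x - y) == 0); case: (dot e (y - z) == 0).
have half b c : b \in B -> c \in B -> b != c ->
    (#|slice E (b - c) 0%R| * 2 = #|E|)%N.
  by move=> bB cB /(orth _ _ bB cB)/forallP/(_ 0)/eqP <-; congr (_ * _)%N.
have halfX : (#|X| * 2 = #|E|)%N by apply: half.
have halfY : (#|Y| * 2 = #|E|)%N by apply: half.
have := half x z xB zB; rewrite eq_sym zx XZ => /(_ isT).
have XYE : X :|: Y \subset E.
  by apply/subsetP => e; rewrite !inE => /orP[] /andP[].
rewrite cardsU [_ :&: (E :\: _)](_ : _ = set0) ?cards0 ?subn0; last first.
  apply/setP => e; rewrite !inE.
  by case: (e \in E); case: (dot e (x - y) == 0); case: (dot e (y - z) == 0).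
have := cardsUI X Y; have := cardsDS XYE; have := subset_leq_card XYE.
move: #|E :\: _| #|X :|: Y| #|X :&: Y| => a b c H1 H2 H3 H4.
by apply/dvdnP; exists c; lia.
Qed.

Lemma balanced_slice E u (k : nat) t : balanced E u -> #|E| = (k * p)%N ->
  #|slice E u t| = k.
Proof.
move=> /forallP/(_ t) + cardE; rewrite cardE eqn_pmul2r ?prime_gt0 // => /eqP.
exact.
Qed.

Lemma balanced_ktiles E u (k : nat) : balanced E u -> #|E| = (k * p)%N ->
  ktiles_with k E [set x | dot x u == 0].
Proof.
move=> bal cardE x; rewrite -(balanced_slice (dot x u) bal cardE).
have inj : injective (fun e : Zpd => (e, x - e)) by move=> e e' [].
rewrite -(card_imset _ inj); apply: eq_card => -[e h]; rewrite inE /=.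
apply/and3P/imsetP => [[eE]|[e' + [-> ->]]]; rewrite !inE.
  move=> /eqP hu /eqP xE; exists e; last by rewrite xE addrAC subrr add0r.
  by rewrite inE eE xE dotDl hu addr0 /=.
by move=> /andP[-> /eqP e'x]; rewrite dotBl e'x subrr addrC subrK !eqxx.
Qed.

(** Each slice of E along u has m points; f numbers them.  A point (x, s) is then
    reached from the s-th point of the slice of E in the hyperplane through x, by
    a translation orthogonal to u that fixes the last coordinate. *)
Lemma balanced_lift_tiles E u (m : nat) : (1 <= m)%N -> balanced E u ->
  #|E| = (m * p)%N ->
  exists f : {x : Zpd | x \in E} -> 'I_m.-1.+1,
    [/\ tiles (graph_in f), {in graph_in f &, injective fst}
      & [set z.1 | z in graph_in f] = E].
Proof.
move=> m1 bal cardE; pose sl x := enum (slice E u (dot x u)).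
have szsl x : size (sl x) = m by rewrite -fintype.cardE (balanced_slice _ bal cardE).
pose f (e : {x : Zpd | x \in E}) : 'I_m.-1.+1 := inord (index (val e) (sl (val e))).
have mem_sl e x : (e \in sl x) = (e \in E) && (dot e u == dot x u).
  by rewrite mem_enum inE.
have f_val e : f e = index (val e) (sl (val e)) :> nat.
  by rewrite inordK // prednK // -(szsl (val e)) index_mem mem_sl eqxx (valP e).
exists f; split.
- exists [set z | (dot z.1 u == 0) && (z.2 == 0)] => -[x s].
  have s_lt : (s < size (sl x))%N by rewrite szsl -{2}(prednK m1) ltn_ord.
  pose e := nth x (sl x) s.
  have : e \in sl x by rewrite mem_nth.
  rewrite mem_sl => /andP[eE /eqP eu].
  have fe : f (Sub e eE) = s.
    by apply: val_inj; rewrite /= f_val /= /sl eu index_uniq ?enum_uniq.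
  exists ((e, s), (x - e, 0)); split.
    split=> /=.
    + by apply/imsetP; exists (Sub e eE); rewrite ?fe.
    + by rewrite inE /= dotBl eu subrr !eqxx.
    + by congr (_, _); rewrite ?addr0 // addrC subrK.
  move=> [[e' s'] [v t]] [/= /imsetP[e0 _ [-> ->]]].
  rewrite inE /= => /andP[/eqP vu /eqP ->] [xE sE].
  have e0u : dot (val e0) u = dot x u by rewrite xE dotDl vu addr0.
  have ee0 : e = val e0.
    rewrite /e sE addr0 f_val /sl e0u nth_index // -/(sl x) mem_sl e0u eqxx.
    by rewrite (valP e0).
  rewrite ee0 {1}sE addr0; congr ((_, _), (_, _)).
  by rewrite xE; apply: addr_subKl.
- move=> z z' /imsetP[e _ ->] /imsetP[e' _ ->] /= /val_inj ->; by [].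
- apply/setP => x; apply/imsetP/idP => [[_ /imsetP[e _ ->] ->]|xE].
    exact: (valP e).
  by exists (x, f (Sub x xE)); rewrite //; apply/imsetP; exists (Sub x xE).
Qed.
End SpecialSizes.

Theorem theorem1p1 (R : realType) (p d : nat) (p_prime : prime p)
    (d_gt0 : (0 < d)%N) (E : {set 'rV['F_p]_d}) (E_neq0 : E != set0) :
  (* (a) *)
  (tiles E -> exists r : nat, (r <= d)%N /\ #|E| = (p ^ r)%N) /\
  (* (b): the exponent d - 2 is an integer, negative when d = 1 *)
  (spectral R E ->
     #|E| = 1%N \/ #|E| = (p ^ d)%N \/
     exists k : nat,
       [/\ #|E| = (k * p)%N, (1 <= k)%N
         & (k%:R : rat) <= (p%:R : rat) ^ (d%:Z - 2)]) /\
  (* (c) *)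
  (p = 2%N -> spectral R E ->
     #|E| = 1%N \/ #|E| = 2%N \/ (4 %| #|E|)%N) /\
  (* (d) *)
  (forall V : {vspace 'rV['F_p]_d},
     (tiles_with E (vset V) <-> spectral_with R E (perp V)) /\
     (tiles_with E (vset V) <->
        exists W : {vspace 'rV['F_p]_d},
          complementary W V /\ graph_over E W V)) /\
  (* (e) *)
  (#|E| = p \/ #|E| = (p ^ (d - 1))%N ->
     (tiles E <-> spectral R E) /\
     (tiles E ->
        (exists V : {vspace 'rV['F_p]_d}, tiles_with E (vset V)) /\
        graph_set E)) /\
  (* (f) *)
  ((d <= 2)%N ->
     (tiles E <-> spectral R E) /\ (tiles E -> graph_set E)) /\
  (* (g) *)
  (d = 3%N -> tiles E -> spectral R E /\ graph_set E) /\
  (* (h) *)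
  (spectral R E ->
     tiles E \/
     exists (k : nat) (H : {set 'rV['F_p]_d}),
       [/\ (1 <= k)%N, #|E| = (k * p)%N, hyperplane H & ktiles_with k E H]) /\
  (* (i) *)
  (forall m : nat, (1 <= m)%N -> spectral R E -> #|E| = (m * p)%N ->
     exists f : {x : 'rV['F_p]_d | x \in E} -> 'I_m.-1.+1,
       [/\ tiles (graph_in f),
           {in graph_in f &, injective fst}
         & [set z.1 | z in graph_in f] = E]) /\
  (* (i), concluding sentence *)
  (spectral R E ->
     exists (m : nat) (T : {set 'rV['F_p]_d * 'I_m.-1.+1}),
       [/\ (1 <= m)%N, tiles T, {in T &, injective fst}
         & [set z.1 | z in T] = E]).
Proof.
have spec_or := spectral_card p_prime E_neq0.
have sub_tse := tiles_subspace_spectral_graph R p_prime E_neq0.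
split; first exact: tiles_card_pow.
split.
  move=> specE; case: (spec_or R specE) => [->|->|[k k0 [cardE small]]]; [by left | |].
    by right; left.
  right; right; exists k; split=> //.
  have p_gt1 := prime_gt1 p_prime.
  have d2 : (2 <= d)%N.
    rewrite -(leq_exp2l _ _ p_gt1); apply: leq_trans small.
    by rewrite -[X in (X <= _)%N]mul1n leq_mul2r k0 orbT.
  rewrite subzn // -exprnP -natrX ler_nat.
  have p2_gt0 : (0 < p ^ 2)%N by rewrite expn_gt0 prime_gt0.
  by rewrite -(leq_pmul2r p2_gt0) -expnD subnK.
split.
  by move=> p2; apply: spectral_char2.
split.
  by move=> V; split; [apply: tiles_subspace_spectral | apply: tiles_subspace_graph].
split.
  move=> cardE.
  have tileV : tiles E -> exists V, tiles_with E (vset V).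
    by case: cardE => [/(tiles_size_p R p_prime)|/(tiles_codim1 R p_prime d_gt0)].
  have specV : spectral R E -> exists V, tiles_with E (vset V).
    case: cardE => [/(spectral_size_p p_prime)|]; first exact.
    by move/(spectral_codim1 p_prime d_gt0); apply.
  split=> [|tE].
    by split=> [/tileV|/specV] [V /sub_tse[]].
  by have [V tEV] := tileV tE; split; [exists V | case: (sub_tse V tEV)].
split.
  move=> d2; have tileV := @tiles_dim_le3 R p d p_prime E (leqW d2).
  split=> [|/tileV[V /sub_tse[]] //].
  split=> [/tileV|/(spectral_dim_le2 p_prime d2 E_neq0)] [V /sub_tse[]] //.
split.
  move=> d3 tE; have d_le3 : (d <= 3)%N by rewrite d3.
  by have [V /sub_tse[]] := tiles_dim_le3 R p_prime d_le3 tE.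
split.
  move=> specE; case: (spectral_balanced p_prime E_neq0 specE) => [E1|[u u0 bal]].
    by left; have [V tEV] := singleton_tiles_subspace E1; exists (vset V).
  right; have /dvdnP[k cardE] := balanced_dvd bal.
  exists k, [set x | dot x u == 0]; split=> //.
  - by move: E_neq0; rewrite -card_gt0 cardE; case: k {cardE}.
  - by exists u, 0.
  - exact: balanced_ktiles.
have lift m : (1 <= m)%N -> spectral R E -> #|E| = (m * p)%N ->
    exists f : {x : 'rV['F_p]_d | x \in E} -> 'I_m.-1.+1,
      [/\ tiles (graph_in f), {in graph_in f &, injective fst}
        & [set z.1 | z in graph_in f] = E].
  move=> m1 specE cardE; have p_gt1 := prime_gt1 p_prime.
  case: (spectral_balanced p_prime E_neq0 specE) => [E1|[u u0 bal]].
    by exfalso; move: E1; rewrite cardE => /eqP; rewrite muln_eq1 (gtn_eqF p_gt1) andbF.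
  exact: balanced_lift_tiles bal cardE.
split=> // specE.
case: (spectral_balanced p_prime E_neq0 specE) => [E1|[u u0 bal]].
  have /cards1P[e ->] : #|E| == 1%N by rewrite E1.
  exists 1%N, [set (e, 0)]; split=> //.
  - by exists setT; apply: tiles_with_setT.
  - by move=> z z' /set1P -> /set1P ->.
  - by rewrite imset_set1.
have /dvdnP[m cardE] := balanced_dvd bal.
have m1 : (1 <= m)%N by move: E_neq0; rewrite -card_gt0 cardE; case: m {cardE}.
by have [f [? ? ?]] := lift m m1 specE cardE; exists m, (graph_in f).
Qed.
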